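(* Let $R$ be a finite ring with identity, $M$ a finite Frobenius $(R,R)$-bimodule and $n\in\mathbb{N}$. Let $\mathcal{C}\subseteq M^n$ be a left $R$-submodule, let $f:\mathcal{C}\longrightarrow M^n$ be a left $R$-linear map, and let $G\leq R^*$ be a subgroup. Suppose $f$ preserves the symmetrized weight composition with respect to $G$, i.e., $\mathrm{swc}_G(f(v))=\mathrm{swc}_G(v)$ for all $v\in\mathcal{C}$. Then there exists a matrix $A\in\mathrm{Mon}_{G,n}(R)$ such that $f(v)=vA$ for all $v\in\mathcal{C}$. As a consequence, the $\mathrm{swc}_G$-preserving linear maps on $M^n$ are given by $G$-monomial maps, that is, maps $v\mapsto vA$ with $A\in\mathrm{Mon}_{G,n}(R)$.
   Context: For a finite ring $R$ with identity, the character group $\widehat{R}=\mathrm{Hom}((R,+),\mathbb{C}^* )$ is an $(R,R)$-bimodule via $(r\cdot\chi)(a)=\chi(ar)$ and $(\chi\cdot r)(a)=\chi(ra)$. A finite $(R,R)$-bimodule $M$ is called a Frobenius bimodule if ${}_RM\cong{}_R\widehat{R}$ as left $R$-modules and $M_R\cong\widehat{R}_R$ as right $R$-modules. $R^*$ is the group of units of $R$. Elements of $M^n$ are row vectors; for a matrix $A\in R^{n\times n}$ and $v\in M^n$, the product $vA\in M^n$ is defined in the usual way using the right $R$-module structure of $M$. $\mathrm{Mon}_{G,n}(R)$ is the group of matrices in $\mathrm{GL}_n(R)$ that have exactly one nonzero entry in each row and each column and whose nonzero entries all lie in $G$. For a subgroup $G\leq R^*$ let $M/G$ be the set of orbits of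 the right action of $G$ on $M$, $(v,u)\mapsto vu$. For $v=(v_1,\ldots,v_n)\in M^n$ and $m\in M/G$ let $\mathrm{swc}_m(v)=|\{i\mid v_i\in m\}|$. The symmetrized weight composition of $v$ with respect to $G$ is $\mathrm{swc}_G(v)=(\mathrm{swc}_m(v))_{m\in M/G}$. *)

(* Defs.v *)
From HB Require Import structures.
From mathcomp Require Import all_boot all_order all_fingroup all_algebra.
From mathcomp Require Import complex reals.

Set Implicit Arguments.
Unset Strict Implicit.
Unset Printing Implicit Defensive.

Import GRing.Theory.
Local Open Scope ring_scope.

(* (R, R)-bimodules: the left action is the [lmodType] scaling [a *: x], the
   right action is written [x :* a]. *)
HB.mixin Record Lmodule_isBimodule (R : nzRingType) M of GRing.Lmodule R M := {
  rscale : M -> R -> M;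
  rscaleDl : forall (x y : M) (a : R), rscale (x + y) a = rscale x a + rscale y a;
  rscaleDr : forall (x : M) (a b : R), rscale x (a + b) = rscale x a + rscale x b;
  rscaleA : forall (x : M) (a b : R), rscale x (a * b) = rscale (rscale x a) b;
  rscale1 : forall x : M, rscale x 1 = x;
  scale_rscaleA : forall (a : R) (x : M) (b : R),
    rscale (a *: x) b = a *: rscale x b
}.

#[short(type="bimodType")]
HB.structure Definition Bimodule (R : nzRingType) :=
  {M of GRing.Lmodule R M & Lmodule_isBimodule R M}.

#[short(type="finBimodType")]
HB.structure Definition FinBimodule (R : nzRingType) :=
  {M of Bimodule R M & Finite M}.

Notation "x :* a" := (rscale x a) : ring_scope.

Section CharacterBimodule.
Variables (K : realType) (R : finNzRingType).

(* For K a model of the real numbers, K[i] is the field of complex numbers;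
   this is Hom((R, +), C^* ). *)
Definition is_char (chi : {ffun R -> K[i]}) : bool :=
  [forall a, chi a != 0] && [forall a, forall b, chi (a + b) == chi a * chi b].

Record charGroup := CharGroup {
  char_val :> {ffun R -> K[i]};
  char_valP : is_char char_val
}.

HB.instance Definition _ := [isSub for char_val].
HB.instance Definition _ := [Choice of charGroup by <:].

Implicit Types chi psi : charGroup.

Lemma char_neq0 chi a : chi a != 0.
Proof. by have /andP[/forallP/(_ a)] := char_valP chi. Qed.

Lemma charD chi a b : chi (a + b) = chi a * chi b.
Proof.
by have /andP[_ /forallP/(_ a)/forallP/(_ b)/eqP] := char_valP chi.
Qed.

Lemma is_charP (g : R -> K[i]) :
  (forall a, g a != 0) -> (forall a b, g (a + b) = g a * g b) ->
  is_char (finfun g).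
Proof.
move=> g0 gD; apply/andP; split; first by apply/forallP=> a; rewrite ffunE.
by apply/forallP=> a; apply/forallP=> b; rewrite !ffunE gD.
Qed.

Lemma charP chi psi : (forall a, chi a = psi a) -> chi = psi.
Proof. by move=> e; apply/val_inj/ffunP. Qed.

(* The group of characters is written additively, as a zmodType. *)
Fact char_zero_subproof : is_char [ffun=> 1].
Proof. by apply: is_charP => *; rewrite ?oner_eq0 ?mulr1. Qed.
Definition char_zero := CharGroup char_zero_subproof.

Fact char_add_subproof chi psi : is_char [ffun a => chi a * psi a].
Proof.
apply: is_charP => [a|a b]; first by rewrite mulf_neq0 ?char_neq0.
by rewrite !charD mulrACA.
Qed.
Definition char_add chi psi := CharGroup (char_add_subproof chi psi).

Fact char_opp_subproof chi : is_char [ffun a => (chi a)^-1].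
Proof.
apply: is_charP => [a|a b]; first by rewrite invr_neq0 ?char_neq0.
by rewrite charD invfM.
Qed.
Definition char_opp chi := CharGroup (char_opp_subproof chi).

Fact char_addA : associative char_add.
Proof. by move=> x y z; apply: charP => a; rewrite !ffunE mulrA. Qed.
Fact char_addC : commutative char_add.
Proof. by move=> x y; apply: charP => a; rewrite !ffunE mulrC. Qed.
Fact char_add0 : left_id char_zero char_add.
Proof. by move=> x; apply: charP => a; rewrite !ffunE mul1r. Qed.
Fact char_addN : left_inverse char_zero char_opp char_add.
Proof.
by move=> x; apply: charP => a; rewrite !ffunE mulVf ?char_neq0.
Qed.

HB.instance Definition _ := GRing.isZmodule.Build charGroup
  char_addA char_addC char_add0 char_addN.

Fact char_scale_subproof (r : R) chi : is_char [ffun a => chi (a * r)].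
Proof.
by apply: is_charP => [a|a b]; rewrite ?char_neq0 // mulrDl charD.
Qed.
Definition char_scale r chi := CharGroup (char_scale_subproof r chi).

Fact char_scaleA r s chi :
  char_scale r (char_scale s chi) = char_scale (r * s) chi.
Proof. by apply: charP => a; rewrite !ffunE mulrA. Qed.
Fact char_scale1 : left_id 1 char_scale.
Proof. by move=> x; apply: charP => a; rewrite ffunE mulr1. Qed.
Fact char_scaleDr : right_distributive char_scale +%R.
Proof. by move=> r x y; apply: charP => a; rewrite !ffunE. Qed.
Fact char_scaleDl chi : {morph char_scale^~ chi : r s / r + s}.
Proof. by move=> r s; apply: charP => a; rewrite !ffunE mulrDr charD. Qed.

HB.instance Definition _ := GRing.Zmodule_isLmodule.Build R charGroup
  char_scaleA char_scale1 char_scaleDr char_scaleDl.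

Fact char_rscale_subproof chi (r : R) : is_char [ffun a => chi (r * a)].
Proof.
by apply: is_charP => [a|a b]; rewrite ?char_neq0 // mulrDr charD.
Qed.
Definition char_rscale chi r := CharGroup (char_rscale_subproof chi r).

Fact char_rscaleDl chi psi r :
  char_rscale (chi + psi) r = char_rscale chi r + char_rscale psi r.
Proof. by apply: charP => a; rewrite !ffunE. Qed.
Fact char_rscaleDr chi r s :
  char_rscale chi (r + s) = char_rscale chi r + char_rscale chi s.
Proof. by apply: charP => a; rewrite !ffunE mulrDl charD. Qed.
Fact char_rscaleA chi r s :
  char_rscale chi (r * s) = char_rscale (char_rscale chi r) s.
Proof. by apply: charP => a; rewrite !ffunE mulrA. Qed.
Fact char_rscale1 chi : char_rscale chi 1 = chi.
Proof. by apply: charP => a; rewrite ffunE mul1r. Qed.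
Fact char_scale_rscaleA (r : R) chi (s : R) :
  char_rscale (r *: chi) s = r *: char_rscale chi s.
Proof. by apply: charP => a; rewrite !ffunE mulrA. Qed.

HB.instance Definition _ := Lmodule_isBimodule.Build R charGroup
  char_rscaleDl char_rscaleDr char_rscaleA char_rscale1 char_scale_rscaleA.

End CharacterBimodule.

Definition right_linear (R : nzRingType) (M N : bimodType R) (g : M -> N) :=
  (forall x y, g (x + y) = g x + g y) /\ (forall x a, g (x :* a) = g x :* a).

(* The left and the right isomorphism need not coincide. *)
Definition frobenius_bimodule (K : realType) (R : finNzRingType)
    (M : finBimodType R) : Prop :=
  (exists2 f : M -> charGroup K R, linear f & bijective f) /\
  (exists2 g : M -> charGroup K R, right_linear g & bijective g).

Section Codes.
Variables (R : finUnitRingType) (M : finBimodType R) (n : nat).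
Implicit Types (G : {group {unit R}}) (v : {ffun 'I_n -> M}) (A : 'M[R]_n).

(* M^n is {ffun 'I_n -> M}, which carries the componentwise left R-module
   structure; 'rV[M]_n only has a module structure when M is a ring. *)
Definition vmulmx v A : {ffun 'I_n -> M} :=
  [ffun j => \sum_(i < n) v i :* A i j].

(* The library's [unitmx] requires a commutative ring. *)
Definition invertible_mx A : Prop :=
  exists B : 'M[R]_n, A *m B = 1%:M /\ B *m A = 1%:M.

Definition monomial_mx G A : Prop :=
  [/\ invertible_mx A,
      forall i, #|[set j | A i j != 0]| = 1%N,
      forall j, #|[set i | A i j != 0]| = 1%N &
      forall i j, A i j != 0 -> exists2 u : {unit R}, u \in G & A i j = val u].

Definition unit_rscale (x : M) (u : {unit R}) : M := x :* val u.

Fact unit_rscale1 x : unit_rscale x 1%g = x.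
Proof. exact: rscale1. Qed.
Fact unit_rscaleM x : act_morph unit_rscale x.
Proof. by move=> u w; rewrite /unit_rscale FinRing.val_unitM rscaleA. Qed.

Definition unit_rscale_action : {action {unit R} &-> M} :=
  TotalAction unit_rscale1 unit_rscaleM.

Definition orbits G : {set {set M}} :=
  [set orbit unit_rscale_action G x | x : M].

Definition swc (m : {set M}) v : nat := #|[set i | v i \in m]|.

Definition swcomp G v : {ffun {m : {set M} | m \in orbits G} -> nat} :=
  [ffun m => swc (val m) v].

End Codes.

(* Main.v *)
(* Evaluating a left isomorphism M -> R^ at 1 yields an additive character chi
   of M whose kernel contains no nonzero left submodule. Hence distinct
   R-linear maps g : C -> M give distinct, thus orthogonal, characters chi o g
   of C. Averaging chi over G turns equality of the symmetrized weight
   compositions into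
     sum_i sum_(u in G) chi (p_i(c) u) = sum_i sum_(u in G) chi (f_i(c) u),
   where p_i and f_i are the coordinates of the inclusion and of f, and
   pairing with chi o g shows that every G-orbit of linear maps C -> M
   contains as many p_i as f_i. *)
Require Import Defs.
From HB Require Import structures.
From mathcomp Require Import all_boot all_order all_fingroup all_algebra.
From mathcomp Require Import complex reals.

Set Implicit Arguments.
Unset Strict Implicit.
Unset Printing Implicit Defensive.

Import GRing.Theory Num.Theory.

Local Open Scope ring_scope.

(** Joins the left module structure with finiteness, so that $M^n$ itself can serve as the finite
    domain [C] of [swcomp_preserving_monomial]. *)
HB.instance Definition _ (R : finUnitRingType) (M : finBimodType R) n :=
  GRing.Lmodule.on {ffun 'I_n -> M}.

(** Equal fibre sizes make the two families equal as multisets. Only values that occur are tested,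
    so in applications [t] is known to be the orbit of a vector entry or of a linear map. *)
Lemma perm_of_fibers (T : eqType) n (a b : 'I_n -> T) :
  (forall t, (exists i, t = a i \/ t = b i) ->
    #|[set i | a i == t]| = #|[set i | b i == t]|) ->
  exists s : 'S_n, forall i, b i = a (s i).
Proof.
move=> ab.
have cE (c : 'I_n -> T) t :
    count_mem t [seq c i | i <- enum 'I_n] = #|[set i | c i == t]|.
  by rewrite count_map cardsE cardE size_filter -enumT; apply: eq_count => i.
have : perm_eq [tuple b i | i < n] [tuple a i | i < n].
  apply/allP => t /=; rewrite mem_cat !cE => t_in; apply/eqP/esym/ab.
  by case/orP: t_in => /mapP[i _ ->]; exists i; [right | left].
case/tuple_permP => s /val_inj bE; exists s => i.
by have := congr1 (fun t => tnth t i) bE; rewrite !tnth_mktuple.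
Qed.

Section RightScaling.
Variables (R : nzRingType) (M : bimodType R).
Implicit Types (x : M) (a : R).

Lemma rscale0r x : x :* 0 = 0.
Proof. by apply: (addrI (x :* 0)); rewrite -rscaleDr !addr0. Qed.

Lemma linear_rscale (U : lmodType R) (g : U -> M) a :
  linear g -> linear (fun y => g y :* a).
Proof. by move=> lg b y z; rewrite lg rscaleDl scale_rscaleA. Qed.

End RightScaling.

(** * Weight compositions and monomial matrices in terms of permutations *)

Section Weights.
Variables (R : finUnitRingType) (M : finBimodType R) (G : {group {unit R}}).
Local Notation to := (unit_rscale_action M).

Lemma swcompP n (v w : {ffun 'I_n -> M}) :
  swcomp G w = swcomp G v <->
  exists s : 'S_n, forall j, w j \in orbit to G (v (s j)).
Proof.
split=> [wv | [s vs]].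
  have [|s sP] := @perm_of_fibers _ _ (fun i => orbit to G (v i))
    (fun i => orbit to G (w i)); last first.
    by exists s => j; have /= <- := sP j; rewrite orbit_refl.
  move=> t tE.
  have tO : t \in orbits M G.
    by case: tE => i [] ->; apply: imset_f.
  move/ffunP/(_ (Sub t tO)): wv; rewrite !ffunE /swc /= => wv.
  have cE (x : {ffun 'I_n -> M}) :
      [set i | orbit to G (x i) == t] = [set i | x i \in t].
    by apply/setP=> i; rewrite !inE; case/imsetP: tO => y _ ->; apply: orbit_eq_mem.
  by rewrite !cE.
apply/ffunP => -[m mO]; rewrite !ffunE /swc /=; case/imsetP: mO => y _ ->.
rewrite -[RHS](card_preimset _ (@perm_inj _ s)); apply: eq_card => j.
by rewrite !inE (orbit_transl _ (vs j)).
Qed.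

(** The row of the only nonzero entry in column [j] defines [s j], and uniqueness within rows makes
    [s] injective. *)
Lemma monomial_mxP n (A : 'M[R]_n) :
  monomial_mx G A <->
  exists s : 'S_n, exists2 u : 'I_n -> {unit R}, forall j, u j \in G &
    forall i j, A i j = if i == s j then val (u j) else 0.
Proof.
have unit_neq0 (x : {unit R}) : val x != 0.
  by apply: contraTneq (valP x) => ->; rewrite unitr0.
split=> [[_ rowA colA entA] | [s [u uG AE]]].
  have colP j : exists i, [set i | A i j != 0] == [set i].
    by have /eqP/cards1P[i ->] := colA j; exists i.
  have rowP i : exists j, [set j | A i j != 0] == [set j].
    by have /eqP/cards1P[j ->] := rowA i; exists j.
  pose s j := xchoose (colP j).
  have sP i j : (A i j != 0) = (i == s j).
    by have /eqP/setP/(_ i) := xchooseP (colP j); rewrite !inE.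
  have s_inj : injective s.
    move=> j k jk; have [l /eqP/setP lP] := rowP (s j).
    have := lP k; have := lP j; rewrite !inE !sP -jk !eqxx.
    by move=> /esym/eqP -> /esym/eqP ->.
  have uP j : exists u : {unit R}, (u \in G) && (A (s j) j == val u).
    have [|u uG ->] := entA (s j) j; first by rewrite sP.
    by exists u; rewrite uG /=.
  exists (perm s_inj), (fun j => xchoose (uP j)) => [j | i j].
    by have /andP[] := xchooseP (uP j).
  rewrite permE -sP; case: eqP => //= /eqP; rewrite sP => /eqP ->.
  by have /andP[_ /eqP] := xchooseP (uP j).
have A0 i j : (A i j != 0) = (i == s j).
  by rewrite AE; case: (i == s j); rewrite ?eqxx ?unit_neq0.
split=> [|i|j|i j].
(* The inverse carries the inverted units at the transposed positions. *)
- exists (\matrix_(i, j) if j == s i then (val (u i))^-1 else 0).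
  split; apply/matrixP => i j; rewrite !mxE.
    rewrite (bigD1 ((s^-1)%g i)) //= big1 => [|k ki]; rewrite AE !mxE.
      rewrite permKV eqxx addr0 eq_sym; case: eqP => _; rewrite ?mulr0 //.
      by rewrite divrr // (valP (u _)).
    case: eqP => [ik|_]; last by rewrite mul0r.
    by case/eqP: ki; rewrite ik permK.
  rewrite (bigD1 (s i)) //= big1 => [|k /negPf ki]; rewrite AE !mxE.
    rewrite eqxx addr0 (inj_eq perm_inj); case: eqP => [<-|_]; last first.
      by rewrite mulr0.
    by rewrite mulVr // (valP (u _)).
  by rewrite ki mul0r.
- rewrite -(cards1 ((s^-1)%g i)); apply: eq_card => j.
  by rewrite !inE A0 -(inj_eq (@perm_inj _ s) j) permKV eq_sym.
- by rewrite -(cards1 (s j)); apply: eq_card => i; rewrite !inE A0.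
- by rewrite A0 AE => ->; exists (u j).
Qed.

Lemma vmulmx_monomial n (A : 'M[R]_n) (s : 'S_n) (u : 'I_n -> {unit R})
    (v : {ffun 'I_n -> M}) :
  (forall i j, A i j = if i == s j then val (u j) else 0) ->
  vmulmx v A = [ffun j => to (v (s j)) (u j)].
Proof.
move=> AE; apply/ffunP => j; rewrite !ffunE (bigD1 (s j)) //= AE eqxx.
by rewrite big1 ?addr0 // => i /negPf si; rewrite AE si rscale0r.
Qed.

End Weights.


(** Inside one orbit, the elements moving [x] to [y] form a coset of a stabilizer. Using the
    stabilizer of [y] gives a factor independent of [x], hence common to all coordinates in
    [orbit_pairing]. *)
Lemma card_amove (aT : finGroupType) (T : finType) (to : {action aT &-> T})
    (G : {group aT}) (x y : T) :
  #|[set u in G | to x u == y]| =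
    ((orbit to G x == orbit to G y) * #|'C_G[y | to]%g|)%N.
Proof.
have [/esym xy | xy] := eqVneq; last first.
  apply/eqP; rewrite mul0n cards_eq0; apply/set0Pn => -[u].
  rewrite inE => /andP[uG /eqP uxy]; case/eqP: xy; apply/orbit_eqP.
  by rewrite orbit_sym -uxy mem_orbit.
have /orbitP[u uG <-] : x \in orbit to G y by rewrite xy orbit_refl.
rewrite mul1n -(card_rcoset 'C_G[y | to]%g u) -amove_act ?subsetT //.
(* Inversion exchanges the elements moving [x] to [y] with those moving [y] to [x], which form a
   right coset of the stabilizer of [y]. *)
rewrite -[LHS](card_preimset _ (@invg_inj _)); apply: eq_card => w.
rewrite !inE groupV; congr (_ && _).
by rewrite -(inj_eq (act_inj to w)) actKV eq_sym.
Qed.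

(** * Orthogonality of characters and orbits of linear maps *)

Section Matching.
Variables (F : numDomainType) (R : finUnitRingType) (M : finBimodType R).
Variables (G : {group {unit R}}) (C : finLmodType R) (chi : M -> F).
Hypothesis chi0 : chi 0 = 1.
Hypothesis chiD : {morph chi : x y / x + y >-> x * y}.
Hypothesis chi_gen : forall x, (forall r, chi (r *: x) = 1) -> x = 0.
Local Notation to := (unit_rscale_action M).

(** If [g c] is nonzero, [chi_gen] yields [r] with [chi (r *: g c) != 1]. Translating the summation
    variable by [r *: c] multiplies the sum by this value, so the sum vanishes. *)
Lemma character_sum (g : C -> M) : linear g ->
  \sum_c chi (g c) = [forall c, g c == 0]%:R * #|C|%:R.
Proof.
move=> lg.
have gD x y : g (x + y) = g x + g y by rewrite -[x]scale1r lg !scale1r.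
have gZ r x : g (r *: x) = r *: g x.
  have g0 : g 0 = 0 by apply: (addrI (g 0)); rewrite -gD !addr0.
  by rewrite -[r *: x]addr0 lg g0 addr0.
have [/forallP g0 | ] := boolP [forall c, g c == 0].
  rewrite (eq_bigr (fun=> 1)) ?sumr_const ?mul1r // => c _.
  by rewrite (eqP (g0 c)).
rewrite negb_forall => /existsP[c gc].
have [/forallP r1 | ] := boolP [forall r, chi (r *: g c) == 1].
  by case/eqP: gc; apply: chi_gen => r; apply/eqP.
rewrite negb_forall => /existsP[r rc]; set S := \sum_c _.
have : S = chi (r *: g c) * S.
  rewrite {1}/S (reindex_inj (addrI (r *: c))) mulr_sumr.
  by apply: eq_bigr => d _; rewrite gD gZ chiD.
move/eqP; rewrite -subr_eq0 -{1}[S]mul1r -mulrBl mulf_eq0 subr_eq0 eq_sym.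
by rewrite (negPf rc) mul0r => /eqP.
Qed.

(** Maps are encoded as finite functions so that their orbits under [G] are finite sets with
    decidable equality; linearity stays a separate hypothesis. *)
Definition ffun_rscale (g : {ffun C -> M}) (u : {unit R}) : {ffun C -> M} :=
  [ffun c => to (g c) u].

Lemma ffun_rscale1 g : ffun_rscale g 1%g = g.
Proof. by apply/ffunP => c; rewrite ffunE act1. Qed.

Lemma ffun_rscaleM g : act_morph ffun_rscale g.
Proof. by move=> u w; apply/ffunP => c; rewrite !ffunE actM. Qed.

Definition ffun_rscale_action := TotalAction ffun_rscale1 ffun_rscaleM.

(** By [character_sum], the pair [(i, u)] contributes [#|C|] if the [i]-th coordinate of [p] scaled
    by [u] is [g], and 0 otherwise; [card_amove] counts these [u]. The factor [chi (- g c)] acts as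
    the inverse of [chi (g c)]. *)
Lemma orbit_pairing n (p : C -> {ffun 'I_n -> M}) (g : {ffun C -> M}) :
  linear p -> linear g ->
  \sum_c chi (- g c) * (\sum_i \sum_(u in G) chi (to (p c i) u)) =
    (#|[set i | orbit ffun_rscale_action G [ffun c => p c i] ==
                orbit ffun_rscale_action G g]| *
     #|'C_G[g | ffun_rscale_action]%g| * #|C|)%:R.
Proof.
move=> lp lg; under eq_bigr do rewrite mulr_sumr.
rewrite exchange_big /= natrM; set N := #|'C_G[g | _]%g|.
transitivity (\sum_i \sum_(u in G)
    (ffun_rscale_action [ffun c => p c i] u == g)%:R * #|C|%:R : F).
  apply: eq_bigr => i _; under eq_bigr do rewrite mulr_sumr.
  rewrite exchange_big /=; apply: eq_bigr => u _.
  transitivity (\sum_c chi (to (p c i) u - g c)).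
    by apply: eq_bigr => c _; rewrite addrC chiD.
  rewrite character_sum => [|r x y]; last first.
    (* Right scaling by [u] commutes with left scalars, so the difference with [g] is still left
       linear. *)
    have lpu : linear (fun c => p c i :* val u).
      by apply: linear_rscale => a c d; rewrite lp !ffunE.
    by rewrite /= /unit_rscale lpu lg scalerBr opprD addrACA.
  congr (_%:R * _); congr nat_of_bool; apply/forallP/eqP => [pg | <- c].
    by apply/ffunP => c; rewrite !ffunE; apply/eqP; rewrite -subr_eq0 pg.
  by rewrite !ffunE subrr.
rewrite (eq_bigr (fun i => (orbit ffun_rscale_action G [ffun c => p c i] ==
    orbit ffun_rscale_action G g)%:R * N%:R * #|C|%:R)); last first.
  move=> i _; rewrite -mulr_suml; congr (_ * _).
  rewrite -natrM -card_amove -sum1_card natr_sum.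
  rewrite [RHS](eq_bigl (fun u => (u \in G) &&
    (ffun_rscale_action [ffun c => p c i] u == g))); last first.
    by move=> u; rewrite inE.
  by rewrite big_mkcondr; apply: eq_bigr => u _; case: eqP.
rewrite -mulr_suml -mulr_suml natrM; congr (_ * _ * _).
rewrite -sum1_card natr_sum [RHS]big_mkcond /=.
by apply: eq_bigr => i _; rewrite inE; case: eqP.
Qed.

(** A general [p] covers both an inclusion and the identity. The permutation given by [swcompP]
    varies with [c]; matching the coordinate maps by their orbits gives one permutation valid for
    all [c]. *)
Lemma swcomp_preserving_monomial n (p f : C -> {ffun 'I_n -> M}) :
  linear p -> linear f -> (forall c, swcomp G (f c) = swcomp G (p c)) ->
  exists2 A : 'M[R]_n, monomial_mx G A & forall c, f c = vmulmx (p c) A.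
Proof.
move=> lp lf fp.
have avg c : \sum_i \sum_(u in G) chi (to (f c i) u) =
    \sum_i \sum_(u in G) chi (to (p c i) u).
  have /swcompP[s sP] := fp c; rewrite [RHS](reindex_inj (@perm_inj _ s)).
  apply: eq_bigr => i _; have /orbitP[w wG <-] := sP i.
  (* The unit [w] relating the two entries is absorbed by a translation of the sum over [G]. *)
  rewrite [RHS](reindex_inj (mulgI w)); apply: eq_big => u.
    by rewrite groupMl.
  by rewrite actM.
have lcoord (q : C -> {ffun 'I_n -> M}) i :
    linear q -> linear [ffun c => q c i].
  by move=> lq a x y; rewrite !ffunE lq !ffunE.
have [|s sP] := @perm_of_fibers _ n
  (fun i => orbit ffun_rscale_action G [ffun c => p c i])
  (fun i => orbit ffun_rscale_action G [ffun c => f c i]).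
  move=> t [i ti].
  have [g lg ->] : exists2 g : {ffun C -> M},
      linear g & t = orbit ffun_rscale_action G g.
    by case: ti => ->; eexists; [exact: lcoord lp | | exact: lcoord lf | ].
  have /eqP : \sum_c chi (- g c) * (\sum_i \sum_(u in G) chi (to (f c i) u)) =
      \sum_c chi (- g c) * (\sum_i \sum_(u in G) chi (to (p c i) u)).
    by under eq_bigr do rewrite avg.
  (* Naturals embed injectively in [F], and the stabilizer order and [#|C|] are positive, so the
     orbit counts agree. *)
  rewrite !orbit_pairing // eqr_nat !eqn_pmul2r ?cardG_gt0 //.
    by move/eqP.
  by apply/card_gt0P; exists 0.
(* The orbit is one of whole functions, so the unit found does not depend on [c]. *)
have uP j : exists u, (u \in G) &&
    (ffun_rscale_action [ffun c => p c (s j)] u == [ffun c => f c j]).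
  have : [ffun c => f c j] \in
      orbit ffun_rscale_action G [ffun c => p c (s j)].
    by have /= <- := sP j; rewrite orbit_refl.
  by case/orbitP => u uG <-; exists u; rewrite uG /=.
pose u j := xchoose (uP j).
pose A : 'M[R]_n := \matrix_(i, j) if i == s j then val (u j) else 0.
have AE i j : A i j = if i == s j then val (u j) else 0 by rewrite mxE.
exists A => [|c].
  apply/monomial_mxP; exists s, u => // j.
  by have /andP[] := xchooseP (uP j).
rewrite (vmulmx_monomial (p c) AE); apply/ffunP => j.
have /andP[_ /eqP/ffunP/(_ c)] := xchooseP (uP j).
by rewrite !ffunE => <-.
Qed.

End Matching.

(** Since [(a *: phi x) 1 = phi x a], the values of [chi] on the submodule generated by [x] are all
    the values of [phi x]. If they are all 1, then [phi x] is trivial and [x = 0] by injectivity. *)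
Lemma frobenius_generating_character (K : realType) (R : finNzRingType)
    (M : finBimodType R) : frobenius_bimodule K M ->
  exists chi : M -> K[i], [/\ chi 0 = 1, {morph chi : x y / x + y >-> x * y} &
    forall x, (forall r, chi (r *: x) = 1) -> x = 0].
Proof.
case=> -[phi lphi /bij_inj phi_inj] _.
have phiD x y : phi (x + y) = phi x + phi y.
  by rewrite -[x]scale1r lphi !scale1r.
have phi0 : phi 0 = 0 by apply: (addrI (phi 0)); rewrite -phiD !addr0.
exists (fun x => phi x 1); split=> [|x y|x x1]; first by rewrite phi0 ffunE.
  by rewrite phiD ffunE.
apply: phi_inj; rewrite phi0; apply: Defs.charP => a; rewrite [RHS]ffunE.
have phiZ : phi (a *: x) = a *: phi x.
  by rewrite -[a *: x]addr0 lphi phi0 addr0.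
by rewrite -(x1 a) phiZ ffunE mul1r.
Qed.

Theorem theorem4p17 (K : realType) (R : finUnitRingType) (M : finBimodType R)
    (n : nat) (G : {group {unit R}}) :
  frobenius_bimodule K M ->
  (forall (S : {pred {ffun 'I_n -> M}}) (C : subLmodType S)
      (f : {linear C -> {ffun 'I_n -> M}}),
    (forall v : C, swcomp G (f v) = swcomp G (val v)) ->
    exists2 A : 'M[R]_n, monomial_mx G A & forall v : C, f v = vmulmx (val v) A)
  /\
  (forall h : {ffun 'I_n -> M} -> {ffun 'I_n -> M},
    (linear h /\ forall v, swcomp G (h v) = swcomp G v) <->
    exists2 A : 'M[R]_n, monomial_mx G A & forall v, h v = vmulmx v A).
Proof.
move=> /frobenius_generating_character[chi [chi0 chiD chi_gen]].
split=> [S C f fP | h].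
  (* [C] inherits finiteness from $M^n$ through the partial inverse [insub] of [val]. *)
  have cK : pcancel (val : C -> {ffun 'I_n -> M}) insub by move=> x; rewrite valK.
  pose C1 : countType := HB.pack C (PCanIsCountable cK).
  pose D : finLmodType R :=
    HB.pack C (PCanIsCountable cK) (@PCanIsFinite C1 _ _ _ cK).
  apply: (@swcomp_preserving_monomial _ _ _ G D chi chi0 chiD chi_gen n val f).
  - by move=> a x y; exact: (linearP (val : {linear C -> {ffun 'I_n -> M}})).
  - by move=> a x y; exact: (linearP f).
  - exact: fP.
split=> [[lh hP] | [A /monomial_mxP[s [u uG AE]] hA]].
  exact: (@swcomp_preserving_monomial _ _ _ G _ chi chi0 chiD chi_gen n id h).
split=> [a x y | v].
  apply/ffunP => j; rewrite !hA !(vmulmx_monomial _ AE) !ffunE /= /unit_rscale.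
  by rewrite rscaleDl scale_rscaleA.
apply/swcompP; exists s => j.
by rewrite hA (vmulmx_monomial _ AE) ffunE mem_orbit.
Qed.
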